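(* For every integer $n \geq 3$, $\gamma_{b,2}(P_4 \square C_n) = 8\left\lfloor \frac{n}{10} \right\rfloor + c(n_{10})$, where $n_{10} \in \{0,1,\dots,9\}$ is the least residue of $n$ modulo $10$ and $c(0)=0$, $c(1)=2$, $c(2)=2$, $c(3)=3$, $c(4)=4$, $c(5)=5$, $c(6)=5$, $c(7)=6$, $c(8)=7$, $c(9)=8$.
   Context: For a graph $G$, a $2$-limited broadcast is a function $f: V(G) \to \{0,1,2\}$. A vertex $u$ hears the broadcast from $v$ if $f(v) > 0$ and $d(u,v) \leq f(v)$, where $d$ is the distance in $G$. The broadcast $f$ is dominating if every vertex of $G$ hears the broadcast from some vertex. The cost of $f$ is $\sum_{v \in V(G)} f(v)$. The $2$-limited broadcast domination number $\gamma_{b,2}(G)$ is the minimum cost of a $2$-limited dominating broadcast on $G$. $C_n$ denotes the cycle on $n$ vertices, $P_4$ the path on $4$ vertices, and $\square$ the Cartesian product of graphs. *)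

(* Defs.v *)
From mathcomp Require Import all_boot.
Unset Printing Implicit Defensive.

(* A graph is given by its (symmetric, irreflexive) adjacency relation on a finType. *)

Definition dist_le (T : finType) (e : rel T) (k : nat) (u v : T) : Prop :=
  exists p : seq T, [/\ path e u p, last u p = v & size p <= k].

Definition limited2 (T : finType) (f : T -> nat) : Prop := forall v, f v <= 2.

Definition hears (T : finType) (e : rel T) (f : T -> nat) (u v : T) : Prop :=
  0 < f v /\ dist_le T e (f v) v u.

Definition dominating_b2 (T : finType) (e : rel T) (f : T -> nat) : Prop :=
  limited2 T f /\ forall u, exists v, hears T e f u v.

Definition bcost (T : finType) (f : T -> nat) : nat := \sum_(v : T) f v.

Definition is_gamma_b2 {T : finType} (e : rel T) (m : nat) : Prop :=
  (exists f : T -> nat, dominating_b2 T e f /\ bcost T f = m) /\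
  (forall f : T -> nat, dominating_b2 T e f -> m <= bcost T f).

Definition path_adj (k : nat) : rel 'I_k := fun i j => (i.+1 == j :> nat) || (j.+1 == i :> nat).

Definition cycle_adj (n : nat) : rel 'I_n :=
  fun i j => (i.+1 %% n == j :> nat) || (j.+1 %% n == i :> nat).

Definition cart_adj (A B : finType) (eA : rel A) (eB : rel B) : rel (A * B) :=
  fun x y => ((x.1 == y.1) && eB x.2 y.2) || ((x.2 == y.2) && eA x.1 y.1).

Definition P4_box_C (n : nat) : rel ('I_4 * 'I_n) := cart_adj _ _ (path_adj 4) (cycle_adj n).

Definition c_tab (r : nat) : nat := nth 0 [:: 0; 2; 2; 3; 4; 5; 5; 6; 7; 8] r.

(* Main.v *)
Require Import Defs.
From mathcomp Require Import all_boot zify.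

(** Only the five columns [j-2 .. j+2] matter for the domination of column [j], so the
    dominating broadcasts on [P_4 \square C_n] are the closed walks of length [n] in a
    finite transfer graph whose edges are the columns.  That graph has a potential and a
    2-colouring for which every edge of cost [c] satisfies
    [5 c - 4 >= (increase of potential) + 2 [both ends have the same colour]].
    Summing over a closed walk with [N] monochromatic edges gives [5 cost >= 4 n + 2 N],
    where [n + N] is even.  So [cost >= 4 n / 5], and for odd [n] the better bound
    [5 cost >= 4 n + 2] yields the extra unit in the residues 1 and 5 modulo 10.
    Conversely, closed walks of lengths 3 to 12 and of optimal cost go through a common
    state, and repeating the one of length 10 and cost 8 reaches every [n]. *)

(** * Distances in the product of the path and the cycle *)

Lemma dist_le_trans (T : finType) (e : rel T) (k l : nat) (u v w : T) :
  dist_le T e k u v -> dist_le T e l v w -> dist_le T e (k + l) u w.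
Proof.
move=> [p [ep lp sp]] [q [eq lq sq]]; exists (p ++ q).
by rewrite cat_path last_cat size_cat lp ep eq lq leq_add.
Qed.

Lemma dist_le_sym (T : finType) (e : rel T) (k : nat) (u v : T) :
  symmetric e -> dist_le T e k u v -> dist_le T e k v u.
Proof.
move=> e_sym [p [ep <- sp]]; exists (rev (belast u p)); split.
- by rewrite rev_path (eq_path (e' := e)) // => x y; rewrite e_sym.
- by case: p {ep sp} => //= x p; rewrite rev_cons last_rcons.
- by rewrite size_rev size_belast.
Qed.

Lemma dist_le_chain (T : finType) (e : rel T) (g : nat -> T) (k : nat) :
  (forall i, i < k -> e (g i) (g i.+1)) -> dist_le T e k (g 0) (g k).
Proof.
elim: k => [|k IHk] eg; first by exists [::].
rewrite -addn1; apply: dist_le_trans (_ : dist_le T e 1 (g k) _).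
  by apply: IHk => i ik; apply: eg; rewrite ltnW.
by exists [:: g k.+1]; rewrite /= addn1 eg.
Qed.

Lemma P4_box_C_sym (n : nat) : symmetric (P4_box_C n).
Proof.
move=> u v; rewrite /P4_box_C /cart_adj !(eq_sym u.1) !(eq_sym u.2).
by congr (_ && _ || _ && _); apply: orbC.
Qed.

(** With truncated subtraction one of the two summands vanishes, so their sum is the absolute
    difference of the rows. *)
Lemma dist_rows (n : nat) (i j : 'I_4) (c : 'I_n) :
  dist_le _ (P4_box_C n) ((j - i) + (i - j)) (i, c) (j, c).
Proof.
wlog ij : i j / i <= j => [wlog_ij|].
  have [/wlog_ij //|/ltnW/wlog_ij ji] := leqP i j.
  by rewrite addnC; apply: dist_le_sym ji; apply: P4_box_C_sym.
have -> : (j - i) + (i - j) = j - i by lia.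
have := dist_le_chain _ (P4_box_C n) (fun t => (inord (i + t), c)) (j - i).
rewrite addn0 subnKC // !inord_val; apply=> t tk.
have j4 := ltn_ord j.
by rewrite /P4_box_C /cart_adj /path_adj /= !inordK ?eqxx ?addnS ?eqxx ?orbT //; lia.
Qed.

Lemma dist_cols (n : nat) (i : 'I_4) (c d : 'I_n) (k : nat) :
  c + k = d %[mod n] -> dist_le _ (P4_box_C n) k (i, c) (i, d).
Proof.
case: n => [|n] in c d *; first by case: c.
move=> ckd.
have := dist_le_chain _ (P4_box_C n.+1) (fun t => (i, inord ((c + t) %% n.+1))) k.
rewrite addn0 ckd !modn_small // !inord_val; apply=> t _.
rewrite /P4_box_C /cart_adj /cycle_adj /= !inordK ?ltn_pmod //.
by rewrite -(addn1 (_ %% _)) modnDml addn1 addnS !eqxx.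
Qed.

(** Converse of the two distance bounds above: [a], [b] count the steps up and down the rows, [x],
    [y] those forward and backward around the cycle. Keeping opposite steps apart avoids negative
    numbers. *)
Lemma path_displacement (n : nat) (u : 'I_4 * 'I_n) (p : seq ('I_4 * 'I_n)) :
  path (P4_box_C n) u p ->
  exists a b x y : nat,
    [/\ u.1 + a = (last u p).1 + b, u.2 + x = (last u p).2 + y %[mod n]
      & a + b + (x + y) <= size p].
Proof.
elim: p u => [|v p IHp] u /=; first by exists 0, 0, 0, 0.
case/andP=> uv /IHp[a [b [x [y [rows cols sz]]]]].
case/orP: uv => /andP[/eqP uv /orP[]/eqP step].
- exists a, b, x.+1, y; split; [by rewrite uv | | lia].
  by rewrite -cols -step modnDml addnS.
- exists a, b, x, y.+1; split; [by rewrite uv | | lia].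
  by rewrite -step modnDml addnS addSn -[in LHS]addn1 -modnDml cols modnDml addn1.
- exists a.+1, b, x, y; split; [by rewrite addnS -addSn step | by rewrite uv | lia].
- exists a, b.+1, x, y; split; [by rewrite -step addSn rows addnS | by rewrite uv | lia].
Qed.

(** * The transfer automaton *)

Notation column := (seq nat).
Notation rowset := (seq bool).

Definition full : rowset := nseq 4 true.

Definition union (a b : rowset) : rowset := [seq x.1 || x.2 | x <- zip a b].

(** Rows that column [w] dominates in a column [k] steps away. The positivity test keeps a zero
    entry from covering its own row when [k] is 0. *)
Definition reach (k : nat) (w : column) : rowset :=
  [seq has (fun q => (0 < nth 0 w q) && ((q - r) + (r - q) + k <= nth 0 w q)) (iota 0 4)
  | r <- iota 0 4].

(** This is the set of rows dominated in the central column [j.+2]; starting at [j] keeps all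
    indices natural. *)
Definition window (x : nat -> column) (j : nat) : rowset :=
  union (union (union (union (reach 2 (x j)) (reach 1 (x j.+1))) (reach 0 (x j.+2)))
    (reach 1 (x j.+3))) (reach 2 (x j.+4)).

(* After reading the columns up to [j], the state [(A, B, C, D)] holds the rows that they
   dominate in the columns [j+1], [j+2], [j] and [j-1], in this order. *)
Definition state := (rowset * rowset * rowset * rowset)%type.

Definition next (s : state) (w : column) : state :=
  let: (a, b, c, d) := s in
  (union b (reach 1 w), reach 2 w, union a (reach 0 w), union c (reach 1 w)).

(** The component tested belongs to the column two places before [w], which no later column of the
    word can help. *)
Definition admits (s : state) (w : column) : bool := union s.2 (reach 2 w) == full.

Fixpoint run (s : state) (x : nat -> column) (j : nat) : state :=
  if j is i.+1 then next (run s x i) (x i) else s.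

Lemma size_reach (k : nat) (w : column) : size (reach k w) = 4.
Proof. by rewrite size_map size_iota. Qed.

Lemma size_union (a b : rowset) : size a = 4 -> size b = 4 -> size (union a b) = 4.
Proof. by move=> a4 b4; rewrite size_map size_zip a4 b4. Qed.

Lemma nth_union (a b : rowset) (r : nat) :
  size a = 4 -> size b = 4 -> r < 4 ->
  nth false (union a b) r = nth false a r || nth false b r.
Proof.
move=> a4 b4 r4; rewrite (nth_map (false, false)) ?size_zip ?a4 ?b4 //.
by rewrite nth_zip ?a4 ?b4.
Qed.

Lemma nth_full (a : rowset) :
  size a = 4 -> (forall r, r < 4 -> nth false a r) -> a = full.
Proof.
move=> a4 a_full; apply: (@eq_from_nth _ false); first by rewrite a4.
by move=> r; rewrite a4 => r4; rewrite a_full // nth_nseq r4.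
Qed.

Lemma reachP (k : nat) (w : column) (r : nat) :
  r < 4 ->
  reflect (exists q, [/\ q < 4, 0 < nth 0 w q & (q - r) + (r - q) + k <= nth 0 w q])
    (nth false (reach k w) r).
Proof.
move=> r4; rewrite (nth_map 0) ?size_iota // nth_iota // add0n.
apply: (iffP hasP) => [[q] | [q [q4 w0 wq]]].
  by rewrite mem_iota => /= q4 /andP[w0 wq]; exists q.
by exists q; rewrite ?mem_iota // w0.
Qed.

Lemma nth_window (x : nat -> column) (j r : nat) :
  r < 4 ->
  nth false (window x j) r =
  [|| nth false (reach 2 (x j)) r, nth false (reach 1 (x j.+1)) r,
      nth false (reach 0 (x j.+2)) r, nth false (reach 1 (x j.+3)) r
    | nth false (reach 2 (x j.+4)) r].
Proof.
by move=> r4; rewrite /window !nth_union ?size_union ?size_reach // -!orbA.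
Qed.

Lemma windowP (x : nat -> column) (j : nat) :
  window x j = full <->
  forall r, r < 4 ->
    exists2 i, i < 5 & nth false (reach ((i - 2) + (2 - i)) (x (j + i))) r.
Proof.
split=> [full_j r r4 | cov].
  have := nth_window x j r r4; rewrite full_j nth_nseq r4 => /esym.
  case/or4P=> [|||/orP[]] Hr.
  - by exists 0; rewrite ?addn0.
  - by exists 1; rewrite ?addn1.
  - by exists 2; rewrite ?addn2.
  - by exists 3; rewrite ?addn3.
  - by exists 4; rewrite ?addn4.
apply: nth_full => [|r r4]; first by rewrite /window !size_union ?size_reach.
rewrite nth_window //; have [i i5] := cov r r4.
by move: i i5 => [|[|[|[|[|//]]]]] _; rewrite ?addn0 ?addn1 ?addn2 ?addn3 ?addn4 => ->;
  rewrite ?orbT.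
Qed.

(** Each step renews the second component from the letter alone, so after four letters nothing of
    [s] is left and the last component is the union of the first four terms of the window. *)
Lemma admits_run (s : state) (x : nat -> column) (j : nat) :
  admits (run s x j.+4) (x j.+4) = (window x j == full).
Proof. by rewrite /=; case: (run s x j) => [[[a b] c] d]. Qed.

Lemma run_periodic (s : state) (x : nat -> column) (n j : nat) :
  (forall i, x (i + n) = x i) -> run s x (j.+4 + n) = run s x j.+4.
Proof.
move=> xn; rewrite !addSn /= -!addSn !xn.
by case: (run s x j) (run s x (j + n)) => [[[a b] c] d] [[[a' b'] c'] d'].
Qed.

Lemma union_full (a : rowset) : size a = 4 -> union full a = full.
Proof. by case: a => [|? [|? [|? [|? []]]]]. Qed.

(** The first four tests concern columns whose windows are incomplete; starting from full row sets
    makes them succeed. *)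
Lemma admits_run_full (x : nat -> column) :
  (forall j, window x j = full) ->
  forall j, admits (run (full, full, full, full) x j) (x j).
Proof.
move=> x_full [|[|[|[|j]]]]; last by rewrite admits_run x_full.
all: by rewrite /admits /= !(union_full (reach _ _)) ?size_reach ?union_full ?size_reach.
Qed.

(** * Dominating broadcasts as cyclic words *)

(** Reducing the index modulo [n.+1] unrolls the cycle into an infinite periodic word, so windows
    need no special case at the seam. *)
Definition columns (n : nat) (f : 'I_4 * 'I_n.+1 -> nat) (j : nat) : column :=
  mkseq (fun r => f (inord r, inord (j %% n.+1))) 4.

Lemma nth_columns (n : nat) (f : 'I_4 * 'I_n.+1 -> nat) (j r : nat) :
  r < 4 -> nth 0 (columns n f j) r = f (inord r, inord (j %% n.+1)).
Proof. by move=> r4; rewrite nth_mkseq. Qed.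

Lemma columns_periodic (n : nat) (f : 'I_4 * 'I_n.+1 -> nat) (j : nat) :
  columns n f (j + n.+1) = columns n f j.
Proof. by rewrite /columns modnDr. Qed.

Lemma sum_columns (n : nat) (f : 'I_4 * 'I_n.+1 -> nat) :
  bcost _ f = \sum_(j < n.+1) sumn (columns n f j).
Proof.
rewrite /bcost (eq_bigr (fun p => f (p.1, p.2))); last by case.
rewrite -(pair_bigA _ (fun i j => f (i, j))) exchange_big; apply: eq_bigr => j _.
rewrite /columns modn_small // inord_val sumnE big_map -/(index_iota 0 4) big_mkord.
by apply: eq_bigr => i _; rewrite inord_val.
Qed.

Lemma dominating_window (n : nat) (f : 'I_4 * 'I_n.+1 -> nat) :
  dominating_b2 _ (P4_box_C n.+1) f -> forall j, window (columns n f) j = full.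
Proof.
move=> [f2 dom] j; apply/windowP => r r4.
have [[q c] [f0 [p [/path_displacement[a [b [x [y [/= rows cols sz]]]]] lastp szp]]]] :=
  dom (inord r, inord ((j + 2) %% n.+1)).
have sz_f := leq_trans sz szp; have sz2 := leq_trans sz_f (f2 _).
rewrite lastp /= !inordK ?ltn_pmod // in rows cols.
(* The source column is [j + 2 + y - x] modulo the length; [x + y <= 2] makes the subtraction exact
   and the offset less than 5. *)
exists (2 + y - x); first lia.
have -> : columns n f (j + (2 + y - x)) = columns n f c.
  rewrite /columns; apply: eq_mkseq => i; congr (f (_, inord _)).
  by apply/eqP; rewrite -(eqn_modDr x) cols modnDml; apply/eqP; congr (_ %% _); lia.
apply/reachP => //; exists q; rewrite nth_columns // modn_small // !inord_val.
by split=> //; lia.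
Qed.

Lemma window_dominating (n : nat) (f : 'I_4 * 'I_n.+1 -> nat) :
  limited2 _ f -> (forall j, window (columns n f) j = full) ->
  dominating_b2 _ (P4_box_C n.+1) f.
Proof.
move=> f2 f_full; split=> // -[r c].
(* Since [2 * n] is -2 modulo [n.+1], the window at [j] is centred at column [c]. *)
pose j := c + 2 * n.
have /windowP/(_ r (ltn_ord r))[i i5] := f_full j.
case/(reachP _ _ _ (ltn_ord r)) => q [q4]; rewrite -[q]/(nat_of_ord (Ordinal q4)).
move: {q q4}(Ordinal q4) => q; rewrite nth_columns // inord_val => f0 fq.
set d := inord _ in f0 fq; exists (q, d); split=> //.
have dE : d = c + i + 2 * n %[mod n.+1].
  by rewrite inordK ?ltn_pmod // modn_mod /j addnAC.
have dc : dist_le _ (P4_box_C n.+1) ((i - 2) + (2 - i)) (r, d) (r, c).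
  (* Column [d] is [c + i - 2] on the cycle: for [i <= 2] one walks forward from [d] to [c],
     otherwise forward from [c] to [d]. *)
  have [i2 | /ltnW i2] := leqP i 2.
    apply: dist_cols; rewrite -modnDml dE modnDml.
    by rewrite (_ : _ + _ = 2 * n.+1 + c) ?modnMDl //; lia.
  apply: dist_le_sym; first exact: P4_box_C_sym.
  apply: dist_cols; rewrite dE.
  by rewrite (_ : c + i + _ = 2 * n.+1 + (c + (i - 2 + (2 - i)))) ?modnMDl //; lia.
have [p [pp lp sp]] := dist_le_trans _ _ _ _ _ _ _ (dist_rows _ q r d) dc.
exists p; split=> //; apply: leq_trans sp (leq_trans _ fq).
by rewrite [X in X + _]addnC.
Qed.

Definition letters (k : nat) : seq column :=
  iter k (fun ws => [seq a :: w | a <- iota 0 3, w <- ws]) [:: [::]].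

Lemma mem_letters (w : column) : all (leq^~ 2) w -> w \in letters (size w).
Proof.
elim: w => [//|a w IHw] /andP[a2 /IHw w_in]; rewrite /letters [size _]/= iterS.
by apply: allpairs_f w_in; rewrite mem_iota.
Qed.

Lemma columns_letters (n : nat) (f : 'I_4 * 'I_n.+1 -> nat) (j : nat) :
  limited2 _ f -> columns n f j \in letters 4.
Proof.
move=> f2; rewrite -[4](size_mkseq (fun r => f (inord r, inord (j %% n.+1)))).
by apply: mem_letters; rewrite all_map; apply/allP => i _; apply: f2.
Qed.

(** * Lower bound *)

(* Each entry [(A, B, C, D, l, p)] gives a state reachable from the full one, with its
   colour [l] and its potential [p]; a row set is coded in binary, row 0 being the lowest
   bit.  The potentials and colours come from a computer search. *)
Definition coded_certificate : seq (nat * nat * nat * nat * nat * nat) := [::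
  (0, 0, 0, 0, 0, 0); (0, 0, 0, 1, 0, 7); (0, 0, 0, 2, 0, 4);
  (0, 0, 0, 3, 0, 8); (0, 0, 0, 4, 1, 3); (0, 0, 0, 5, 1, 5);
  (0, 0, 0, 6, 1, 4); (0, 0, 0, 7, 0, 5); (0, 0, 0, 8, 1, 6);
  (0, 0, 0, 9, 1, 5); (0, 0, 0, 10, 1, 4); (0, 0, 0, 11, 1, 6);
  (0, 0, 0, 12, 1, 6); (0, 0, 0, 13, 0, 9); (0, 0, 0, 14, 0, 5);
  (0, 0, 0, 15, 0, 6); (0, 0, 1, 3, 0, 6); (0, 0, 1, 7, 1, 6);
  (0, 0, 1, 11, 1, 7); (0, 0, 1, 15, 1, 11); (0, 0, 2, 7, 1, 5);
  (0, 0, 2, 15, 1, 8); (0, 0, 3, 7, 1, 9); (0, 0, 3, 15, 1, 12);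
  (0, 0, 4, 14, 0, 5); (0, 0, 4, 15, 0, 7); (0, 0, 5, 15, 0, 9);
  (0, 0, 6, 15, 0, 8); (0, 0, 7, 15, 0, 11); (0, 0, 8, 12, 0, 6);
  (0, 0, 8, 13, 0, 7); (0, 0, 8, 14, 0, 6); (0, 0, 8, 15, 0, 10);
  (0, 0, 9, 15, 0, 9); (0, 0, 10, 15, 0, 8); (0, 0, 11, 15, 0, 10);
  (0, 0, 12, 14, 1, 8); (0, 0, 12, 15, 0, 10); (0, 0, 13, 15, 1, 13);
  (0, 0, 14, 15, 0, 11); (0, 0, 15, 15, 0, 12); (1, 0, 3, 1, 0, 5);
  (1, 0, 3, 3, 0, 9); (1, 0, 3, 5, 1, 8); (1, 0, 3, 7, 1, 9);
  (1, 0, 3, 9, 0, 8); (1, 0, 3, 11, 1, 9); (1, 0, 3, 13, 1, 11);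
  (1, 0, 3, 15, 1, 10); (1, 0, 7, 15, 0, 10); (1, 0, 11, 13, 0, 11);
  (1, 0, 11, 15, 0, 11); (1, 0, 15, 15, 0, 15); (2, 0, 7, 2, 0, 5);
  (2, 0, 7, 3, 0, 11); (2, 0, 7, 6, 1, 8); (2, 0, 7, 7, 1, 10);
  (2, 0, 7, 10, 0, 7); (2, 0, 7, 11, 1, 10); (2, 0, 7, 14, 0, 9);
  (2, 0, 7, 15, 0, 9); (2, 0, 15, 14, 1, 9); (2, 0, 15, 15, 0, 12);
  (3, 0, 7, 3, 0, 10); (3, 0, 7, 7, 1, 13); (3, 0, 7, 11, 0, 12);
  (3, 0, 7, 15, 0, 13); (3, 0, 15, 15, 0, 16); (3, 1, 7, 3, 0, 9);
  (3, 1, 7, 7, 1, 11); (3, 1, 7, 11, 1, 12); (3, 1, 7, 15, 0, 14);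
  (3, 1, 15, 15, 0, 14); (4, 0, 14, 4, 1, 7); (4, 0, 14, 5, 1, 10);
  (4, 0, 14, 6, 0, 7); (4, 0, 14, 7, 1, 10); (4, 0, 14, 12, 1, 9);
  (4, 0, 14, 13, 1, 10); (4, 0, 14, 14, 1, 8); (4, 0, 14, 15, 1, 9);
  (4, 0, 15, 7, 0, 9); (4, 0, 15, 15, 1, 11); (5, 0, 15, 5, 1, 12);
  (5, 0, 15, 7, 0, 12); (5, 0, 15, 13, 0, 13); (5, 0, 15, 15, 1, 13);
  (6, 0, 15, 6, 0, 10); (6, 0, 15, 7, 1, 14); (6, 0, 15, 14, 0, 12);
  (6, 0, 15, 15, 1, 12); (7, 0, 15, 7, 0, 15); (7, 0, 15, 15, 0, 17);
  (7, 1, 15, 7, 1, 16); (7, 1, 15, 15, 1, 16); (7, 2, 15, 7, 0, 10);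
  (7, 2, 15, 15, 1, 13); (7, 3, 15, 7, 1, 20); (7, 3, 15, 15, 1, 22);
  (8, 0, 12, 8, 1, 7); (8, 0, 12, 9, 0, 8); (8, 0, 12, 10, 0, 7);
  (8, 0, 12, 11, 0, 9); (8, 0, 12, 12, 1, 8); (8, 0, 12, 13, 0, 8);
  (8, 0, 12, 14, 1, 8); (8, 0, 12, 15, 1, 10); (8, 0, 13, 11, 1, 9);
  (8, 0, 13, 15, 1, 11); (8, 0, 14, 15, 1, 10); (8, 0, 15, 15, 1, 14);
  (9, 0, 15, 9, 0, 10); (9, 0, 15, 11, 0, 12); (9, 0, 15, 13, 1, 13);
  (9, 0, 15, 15, 1, 13); (10, 0, 15, 10, 0, 10); (10, 0, 15, 11, 0, 13);
  (10, 0, 15, 14, 1, 13); (10, 0, 15, 15, 1, 12); (11, 0, 15, 11, 0, 15);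
  (11, 0, 15, 15, 0, 16); (11, 1, 15, 11, 1, 16); (11, 1, 15, 15, 1, 16);
  (12, 0, 14, 12, 1, 12); (12, 0, 14, 13, 1, 15); (12, 0, 14, 14, 0, 12);
  (12, 0, 14, 15, 1, 14); (12, 0, 15, 15, 1, 14); (12, 8, 14, 12, 1, 11);
  (12, 8, 14, 13, 0, 12); (12, 8, 14, 14, 0, 11); (12, 8, 14, 15, 0, 13);
  (12, 8, 15, 15, 0, 14); (13, 0, 15, 13, 1, 17); (13, 0, 15, 15, 0, 17);
  (13, 8, 15, 13, 0, 14); (13, 8, 15, 15, 0, 16); (14, 0, 15, 14, 0, 15);
  (14, 0, 15, 15, 0, 17); (14, 4, 15, 14, 0, 10); (14, 4, 15, 15, 0, 13);
  (14, 8, 15, 14, 0, 14); (14, 8, 15, 15, 0, 14); (14, 12, 15, 14, 0, 19);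
  (14, 12, 15, 15, 0, 20); (15, 0, 15, 15, 0, 18); (15, 1, 15, 15, 1, 21);
  (15, 2, 15, 15, 1, 17); (15, 3, 15, 15, 1, 24); (15, 4, 15, 15, 0, 15);
  (15, 5, 15, 15, 0, 19); (15, 6, 15, 15, 0, 20); (15, 7, 15, 15, 1, 24);
  (15, 8, 15, 15, 0, 19); (15, 9, 15, 15, 0, 19); (15, 10, 15, 15, 0, 19);
  (15, 11, 15, 15, 0, 24); (15, 12, 15, 15, 0, 23); (15, 13, 15, 15, 1, 24);
  (15, 14, 15, 15, 0, 24); (15, 15, 15, 15, 0, 24)].

Definition decode_rows (m : nat) : rowset := mkseq (fun i => odd (iter i half m)) 4.

Definition certificate : seq (state * (bool * nat)) :=
  [seq let: (a, b, c, d, l, p) := e in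
       ((decode_rows a, decode_rows b, decode_rows c, decode_rows d), (l == 1, p))
  | e <- coded_certificate].

Definition states : seq state := unzip1 certificate.

Definition labels : seq (bool * nat) := unzip2 certificate.

Definition label (s : state) : bool * nat := nth (false, 0) labels (index s states).

(** The inequality on edges, with the old potential moved to the right so that no subtraction
    occurs. *)
Definition certified_step (s t : state) (w : column) : bool :=
  let: (l, p) := label s in
  let: (l', p') := label t in
  p' + 4 + (l == l').*2 <= p + 5 * sumn w.

Lemma certificateP (s : state) (w : column) :
  s \in states -> w \in letters 4 -> admits s w ->
  next s w \in states /\ certified_step s (next s w) w.
Proof.
move=> s_in w_in sw.
(* Finite check over all listed states and all 81 columns. One lookup [i] gives both membership of
   the next state and its label. *)
have /allP/(_ s s_in) : all (fun s => let: (l, p) := label s in all (fun w =>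
    if admits s w then
      let i := index (next s w) states in
      if i < size states then
        let: (l', p') := nth (false, 0) labels i in p' + 4 + (l == l').*2 <= p + 5 * sumn w
      else false
    else true) (letters 4)) states by vm_compute.
rewrite /certified_step; case: (label s) => l p /allP/(_ w w_in).
by rewrite sw index_mem; case: ifP.
Qed.

(** [N] counts the monochromatic edges among the [m] edges read from time [a]. The colour flips on
    the other [m - N], a number with the parity of [m + N]. *)
Lemma run_potential (x : nat -> column) (a m : nat) :
  (forall j, window x j = full) -> (forall j, x j \in letters 4) ->
  let s := run (full, full, full, full) x in
  exists N,
    (label (s (a + m))).2 + 4 * m + 2 * N
      <= (label (s a)).2 + 5 * \sum_(i < m) sumn (x (a + i)) /\
    (label (s (a + m))).1 = (label (s a)).1 (+) odd (m + N).
Proof.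
move=> x_full x_letters s.
have s_states j : s j \in states.
  elim: j => [|j IHj]; first by vm_compute.
  by have [] := certificateP _ _ IHj (x_letters j) (admits_run_full x x_full j).
elim: m => [|m [N [pot col]]].
  by exists 0; rewrite big_ord0 !addn0 addbF.
have [_] := certificateP _ _ (s_states (a + m)) (x_letters _) (admits_run_full x x_full _).
have -> : next (s (a + m)) (x (a + m)) = s (a + m.+1) by rewrite addnS.
rewrite /certified_step big_ord_recr /=.
case: (label (s (a + m))) (label (s (a + m.+1))) pot col => [l p] [l' p'] /= pot lE step.
exists (N + (l == l')); split; first by lia.
by rewrite addnA oddD oddb lE; case: (label (s a)).1 (odd (m + N)) l' {step} => [] [] [].
Qed.

Lemma sum_shift (x : nat -> nat) (n a : nat) :
  (forall i, x (i + n) = x i) -> \sum_(i < n) x (a + i) = \sum_(i < n) x i.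
Proof.
move=> xn; elim: a => [//|a <-].
case: n xn => [|n] xn; first by rewrite !big_ord0.
rewrite big_ord_recr big_ord_recl /= addn0 -(xn a) addnC addSnnS; congr (_ + _).
by apply: eq_bigr => i _; rewrite addSnnS.
Qed.

Lemma cost_lower_bound (n : nat) (f : 'I_4 * 'I_n.+1 -> nat) :
  dominating_b2 _ (P4_box_C n.+1) f ->
  exists N, 4 * n.+1 + 2 * N <= 5 * bcost _ f /\ ~~ odd (n.+1 + N).
Proof.
move=> f_dom; have [f2 _] := f_dom.
(* From time 4 on the state is periodic, so over one period potentials cancel and colours agree. *)
have [N []] := run_potential _ 4 n.+1 (dominating_window n f f_dom)
  (fun j => columns_letters n f j f2).
rewrite run_periodic; last exact: columns_periodic.
rewrite (sum_shift (fun j => sumn (columns n f j))) => [|i]; last first.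
  by rewrite columns_periodic.
rewrite -sum_columns => cost col; exists N; split; first by lia.
by move: col; case: (label _).1; case: (odd _).
Qed.

(** * Upper bound *)

Fixpoint accepts (s : state) (word : seq column) (t : state) : bool :=
  if word is w :: word' then admits s w && accepts (next s w) word' t else s == t.

Lemma accepts_cat (s t u : state) (v w : seq column) :
  accepts s v t -> accepts t w u -> accepts s (v ++ w) u.
Proof.
elim: v s => [|a v IHv] s /=; first by move=> /eqP->.
by case/andP=> -> /IHv.
Qed.

Lemma accepts_admits (s : state) (word : seq column) (x : nat -> column) (j : nat) :
  0 < size word -> (forall i, x i = nth [::] word (i %% size word)) ->
  accepts s word s -> admits (run s x j) (x j).
Proof.
move=> size0 xE acc.
(* Invariant: from the state at time [i], the unread part of the current copy of the word leads back
   to [s]. At the end of a copy the state is [s] itself and the next copy begins. *)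
have rest i : accepts (run s x i) (drop (i %% size word) word) s.
  elim: i => [|i]; first by rewrite mod0n drop0.
  rewrite (drop_nth [::]) ?ltn_pmod //= => /andP[_].
  rewrite -xE -[i.+1]addn1 -modnDml addn1.
  have := ltn_pmod i size0; rewrite leq_eqVlt => /predU1P[->|lt_i].
    by rewrite drop_size modnn drop0 => /eqP->.
  by rewrite (modn_small lt_i).
by have := rest j; rewrite (drop_nth [::]) ?ltn_pmod // xE => /andP[].
Qed.

Lemma broadcast_of_word (n : nat) (s : state) (word : seq column) :
  size word = n.+1 -> all (mem (letters 4)) word -> accepts s word s ->
  exists f : 'I_4 * 'I_n.+1 -> nat,
    dominating_b2 _ (P4_box_C n.+1) f /\ bcost _ f = sumn (map sumn word).
Proof.
move=> sz let_word acc.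
pose x i := nth [::] word (i %% size word).
have x_letters i : x i \in letters 4.
  by apply: (allP let_word); rewrite mem_nth // ltn_pmod // sz.
have lettersP w : w \in letters 4 -> (size w == 4) && all (leq^~ 2) w.
  by apply/allP: w; vm_compute.
pose f (v : 'I_4 * 'I_n.+1) := nth 0 (x v.2) v.1.
have colE j : columns n f j = x j.
  have /andP[/eqP x4 _] := lettersP _ (x_letters j).
  apply: (@eq_from_nth _ 0) => [|r]; rewrite size_mkseq ?x4 // => r4.
  by rewrite nth_mkseq // /f /x /= !inordK ?ltn_pmod // sz modn_mod.
exists f; split.
  apply: window_dominating => [[r c]|j].
    have /andP[/eqP x4 /allP x2] := lettersP _ (x_letters c).
    by apply: x2; rewrite mem_nth ?x4.
  have -> : window (columns n f) j = window x j by rewrite /window !colE.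
  by apply/eqP; rewrite -(admits_run s); apply: (accepts_admits _ word) => //; rewrite sz.
rewrite sum_columns sumnE big_map (big_nth [::]) sz big_mkord.
by apply: eq_bigr => i _; rewrite colE /x sz modn_small.
Qed.

Definition col (m : nat) : column :=
  [:: m %/ 1000; m %/ 100 %% 10; m %/ 10 %% 10; m %% 10].

(* A column is coded by its four decimal digits.  The words have the lengths 3 to 12 and
   label closed walks at the state [base_state] below. *)
Definition base_words : seq (seq column) := [::
  [:: col 1; col 200; col 0];
   [:: col 1; col 1000; col 200; col 0];
   [:: col 0; col 1002; col 0; col 200; col 0];
   [:: col 0; col 1002; col 0; col 0; col 200; col 0];
   [:: col 1; col 1000; col 0; col 20; col 0; col 200; col 0];
   [:: col 1; col 0; col 2010; col 0; col 1; col 0; col 200; col 0];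
   [:: col 0; col 2; col 2000; col 0; col 0; col 20; col 0; col 200; col 0];
   [:: col 1; col 1000; col 0; col 20; col 0; col 1000; col 1; col 0;
       col 200; col 0];
   [:: col 1; col 1000; col 0; col 20; col 0; col 1000; col 1; col 0;
       col 200; col 200; col 0];
   [:: col 0; col 2; col 2000; col 0; col 0; col 20; col 0; col 1000; col 1;
       col 0; col 200; col 0]].

(** What [col 200; col 0], the ending of every base word, leaves behind: a 2 in row 1 dominates its
    whole column, rows 0 to 2 of the next and row 1 of the one after. *)
Definition base_state : state :=
  (decode_rows 2, decode_rows 0, decode_rows 7, decode_rows 15).

Definition base_word (r : nat) : seq column := nth [::] base_words (r - 3).

Lemma base_wordP (r : nat) :
  3 <= r <= 12 ->
  [&& size (base_word r) == r, all (mem (letters 4)) (base_word r),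
      accepts base_state (base_word r) base_state
    & sumn (map sumn (base_word r)) == 8 * (r %/ 10) + c_tab (r %% 10)].
Proof.
move=> r312; have {r312} : r \in iota 3 10 by rewrite mem_iota.
by apply/allP: r; vm_compute.
Qed.

Lemma cyclic_word (r q : nat) :
  3 <= r <= 12 ->
  exists word,
    [/\ size word = q * 10 + r, all (mem (letters 4)) word,
        accepts base_state word base_state
      & sumn (map sumn word) = q * 8 + (8 * (r %/ 10) + c_tab (r %% 10))].
Proof.
move=> r312; elim: q => [|q [word [sz lets acc cost]]].
  by have /and4P[/eqP sz lets acc /eqP cost] := base_wordP r r312; exists (base_word r).
(* The word of length 10 costs 8 and returns to the common state, so it can be prepended to any
   closed walk there. *)
have /and4P[/eqP sz' lets' acc' /eqP cost'] := base_wordP 10 isT.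
exists (base_word 10 ++ word); split; first by rewrite size_cat sz sz' mulSn addnA.
- by rewrite all_cat lets'.
- exact: accepts_cat acc' acc.
- by rewrite map_cat sumn_cat cost cost' mulSn addnA.
Qed.

Theorem theorem4p9 (n : nat) (hn : 3 <= n) :
  is_gamma_b2 (P4_box_C n) (8 * (n %/ 10) + c_tab (n %% 10)).
Proof.
case: n hn => // n hn; split=> [|f /cost_lower_bound[N [cost even]]]; last first.
  have n10 := divn_eq n.+1 10; have r10 : n.+1 %% 10 < 10 by rewrite ltn_pmod.
  move: (n.+1 %/ 10) (n.+1 %% 10) n10 r10 => q r n10.
  (* In residues 1 and 5 the length is odd, so parity forces [N >= 1]; elsewhere rounding up four
     fifths of the length suffices. *)
  by move: r n10 => [|[|[|[|[|[|[|[|[|[|//]]]]]]]]]] n10 _; rewrite /c_tab /=; lia.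
(* Shifting by 3 puts [r] between 3 and 12, the range of the base words. *)
pose q := (n.+1 - 3) %/ 10; pose r := (n.+1 - 3) %% 10 + 3.
have nE : n.+1 = q * 10 + r by rewrite /q /r; lia.
have [|word [sz lets acc cost]] := cyclic_word r q; first by rewrite /r; lia.
have [f [f_dom f_cost]] := broadcast_of_word n _ _ (etrans sz (esym nE)) lets acc.
exists f; split=> //; rewrite f_cost cost nE divnMDl // modnMDl; lia.
Qed.
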